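(* For every tree $T$, $\phi(T) \leq 4\,\mathrm{pw}(T) + 1$. Moreover, for every integer $p \geq 0$ there is a tree $T$ such that $\phi(T) \geq p \geq \mathrm{pw}(T)$.
   Context: Graphs are finite, simple and undirected. $\mathrm{pw}(T)$ denotes the pathwidth of $T$: the minimum over all path decompositions of $T$ of the maximum bag size minus one, where a path decomposition of $T$ is a sequence $B_1,\dots,B_s$ of subsets (bags) of $V(T)$ such that every vertex lies in some bag, both endpoints of every edge lie together in some bag, and for each vertex the indices of the bags containing it form an interval. An anagram is a word of the form $W_1W_2$ where $W_1$ is a non-empty word and $W_2$ is a permutation of $W_1$ (i.e. each symbol occurs equally often in $W_1$ and $W_2$). A vertex colouring of a graph $G$ is a function $f:V(G)\to C$ where $C$ is a set of colours (no properness is assumed). A vertex colouring of $G$ is anagram-free if for every path $v_1,\dots,v_n$ that is a subgraph of $G$, the sequence of colours $f(v_1)\cdots f(v_n)$ is not an anagram. The anagram-free chromatic number $\phi(G)$ is the minimum number of colours in an anagram-free vertex colouring of $G$. *)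

(* Defs.v *)
(* MathComp; `[< P >] is the classical truth value of P : Prop (boolp). *)
From mathcomp Require Import all_boot.
From mathcomp Require Import boolp.

Set Implicit Arguments.
Unset Strict Implicit.
Unset Printing Implicit Defensive.

Record sgraph := SGraph {
  vertex :> finType;
  adj : rel vertex;
  adj_sym : symmetric adj;
  adj_irrefl : irreflexive adj
}.

Definition connected_graph (G : sgraph) : Prop :=
  0 < #|G| /\ forall x y : G, connect (@adj G) x y.

(* An edge {u, v} yields the [ucycle] [:: u; v], hence the bound on the size. *)
Definition acyclic_graph (G : sgraph) : Prop :=
  forall c : seq G, ucycle (@adj G) c -> size c < 3.

Definition is_tree (G : sgraph) : Prop :=
  connected_graph G /\ acyclic_graph G.

(* [sorted] only constrains consecutive elements: this is the sequence
   v_1, ..., v_n (n > 0) of distinct vertices of a path subgraph of G. *)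
Definition is_path (G : sgraph) (s : seq G) : bool :=
  [&& s != [::], uniq s & sorted (@adj G) s].

Definition anagram (C : eqType) (w : seq C) : Prop :=
  exists w1 w2 : seq C, [/\ w = w1 ++ w2, w1 <> [::] & perm_eq w1 w2].

Definition anagram_free (G : sgraph) (C : eqType) (f : G -> C) : Prop :=
  forall s : seq G, is_path s -> ~ anagram (map f s).

Definition anagram_free_colourable (G : sgraph) (k : nat) : Prop :=
  exists f : G -> 'I_k, anagram_free f.

Definition path_decomposition (G : sgraph) (B : seq {set G}) : Prop :=
  [/\ forall v : G, exists2 b, b \in B & v \in b,
      forall u v : G, adj u v -> exists2 b, b \in B & (u \in b) && (v \in b)
    & forall (v : G) (i j k : nat), i <= j <= k -> k < size B ->
        v \in nth set0 B i -> v \in nth set0 B k -> v \in nth set0 B j].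

(* Truncated predecessor: only the graph with no vertices, whose width would
   be -1, is affected. *)
Definition pd_width (G : sgraph) (B : seq {set G}) : nat :=
  (\max_(b <- B) #|b|).-1.

Definition has_pd_of_width (G : sgraph) (k : nat) : Prop :=
  exists2 B : seq {set G}, path_decomposition B & pd_width B = k.

Lemma colourable_ex (G : sgraph) :
  exists k, `[< anagram_free_colourable G k >].
Proof.
exists #|G|; apply/asboolP; exists enum_rank => s /and3P[_ s_uniq _].
move=> [[|a w1] [w2 [Es nz eq_w]]] //.
have: uniq ((a :: w1) ++ w2) by rewrite -Es map_inj_uniq //; apply: enum_rank_inj.
rewrite cat_uniq => /and3P[_ /hasPn/(_ a)].
by rewrite -(perm_mem eq_w) /= inE eqxx => /(_ isT).
Qed.

Lemma pd_ex (G : sgraph) : exists k, `[< has_pd_of_width G k >].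
Proof.
exists (pd_width [:: [set: G]]); apply/asboolP.
exists [:: [set: G]] => //; split=> [v|u v _|v i j k /andP[_ le_jk] lt_k _ _].
- by exists setT; rewrite !inE.
- by exists setT; rewrite !inE.
- by case: j le_jk => [|j]; [rewrite inE | case: k lt_k].
Qed.

Definition phi (G : sgraph) : nat := ex_minn (colourable_ex G).

Definition pathwidth (G : sgraph) : nat := ex_minn (pd_ex G).

(* Main.v *)
From Stdlib Require Import ZArith Lia.
Require Import Defs.
From mathcomp Require Import all_boot zify_ssreflect.

(** Upper bound.  Let every bag of a path decomposition of a tree meet a set
    [S] of vertices in at most [k.+1] vertices.  By induction on [k], [S] has
    a colouring with [4 * k + 1] colours in which no path inside [S] is an
    anagram ([colour_set]).  If [k = 0] there are no edges inside [S], and one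
    colour is enough.  Otherwise take, in each component of [S], a path from
    the first bag that meets the component to the last one: since neighbours
    share a bag, this path meets every bag that the component meets
    ([ex_hitting_path]), so removing it lowers the bound by one.  What is left
    is coloured by induction, and each removed path is coloured, vertex after
    vertex, by the letters of a word without abelian squares over four fresh
    colours.  Paths in a tree are unique, so any path of the tree meets a
    removed path in a contiguous piece ([acyclic_path_meet]); restricting an
    anagram to the fresh colours would therefore give an abelian square in the
    word.

    The word.  Arbitrarily long words without abelian squares over four
    letters exist by a theorem of Keränen: an explicit substitution of length
    85 sends words without abelian squares to such words ([image_square]).  An
    abelian square in an image is given by three cut positions such that each
    letter occurs equally often between the first two and between the last
    two.  Moving each cut to a boundary of its block yields three positions in
    the original word.  The letter counts of the blocks form an invertible
    matrix of determinant 43435, and a linear form modulo 43435 that vanishes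
    on all blocks leaves only few possibilities for the offsets of the cuts in
    their blocks; the computation [cuts_okT] shows that in all of them the
    cuts can be moved so that the balance of letters is kept.  The three new
    positions then delimit an abelian square in the original word, unless they
    fail to advance; in that case the square lies in the images of two
    consecutive letters, which [pairs_okT] excludes by computation if the
    letters differ, while equal letters are an abelian square themselves.

    Lower bound.  The complete [d]-ary tree of height [p] has pathwidth at
    most [p]: its root-to-leaf paths, in the order of the leaves, are the bags
    of a path decomposition.  If it is coloured with [k] colours and [d]
    exceeds the number of colour sequences of length at most [p], then by the
    pigeonhole principle it contains a complete binary tree, from the root to
    the last level, in which the colour of a vertex depends only on its level
    ([ex_level_mono]).  If levels [i < j] of it had the same colour, then the
    path that climbs from level [j - 1] to a vertex of level [i] and goes down
    in the other branch to level [j] would be an anagram: its first half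
    carries the colours of the levels [i] to [j - 1], the second those of the
    levels [i + 1] to [j] ([level_mono_uniq]).  So the [p + 1] levels have
    distinct colours, and [k] is greater than [p]. *)

Set Implicit Arguments.
Unset Strict Implicit.
Unset Printing Implicit Defensive.

(** * Words over four letters and their letter counts *)

Definition occ (c : nat) (u : seq nat) : nat := count_mem c u.

Definition letters4 (u : seq nat) : bool := all (fun c => c < 4) u.

(** Two adjacent blocks of [w] that are anagrams of each other, given by cut
    positions and letter counts of prefixes: in this form the condition is
    linear, and a substitution acts on it by a matrix. *)
Definition square_at (w : seq nat) (t0 t1 t2 : nat) : Prop :=
  [/\ t0 < t1, t1 < t2, t2 <= size w
    & forall c, occ c (take t0 w) + occ c (take t2 w) = 2 * occ c (take t1 w)].

Lemma occ_cat c u v : occ c (u ++ v) = occ c u + occ c v.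
Proof. by rewrite /occ count_cat. Qed.

Lemma occ_cons c x u : occ c (x :: u) = (x == c) + occ c u.
Proof. by []. Qed.

Lemma occ_takeS c q w :
  q < size w -> occ c (take q.+1 w) = occ c (take q w) + (nth 0 w q == c).
Proof.
by move=> lt_q; rewrite (take_nth 0) // -cats1 occ_cat occ_cons addn0.
Qed.

Lemma letters4_take t w : letters4 w -> letters4 (take t w).
Proof. by move=> /allP w4; apply/allP=> x /mem_take/w4. Qed.

Lemma letters4_nth q w : letters4 w -> nth 0 w q < 4.
Proof.
move=> /allP w4; case: (ltnP q (size w)) => [/(mem_nth 0)/w4 //|le_w].
by rewrite nth_default.
Qed.

Lemma forall_lt4 (P : nat -> Prop) :
  P 0 -> P 1 -> P 2 -> P 3 -> forall c, c < 4 -> P c.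
Proof. by move=> P0 P1 P2 P3 [|[|[|[|c]]]]. Qed.

Lemma occ_ge4 c w : letters4 w -> 4 <= c -> occ c w = 0.
Proof.
move=> /allP w4 le4c; apply/count_memPn/negP => /w4.
by rewrite ltnNge le4c.
Qed.

Lemma size_occ u :
  letters4 u -> size u = occ 0 u + occ 1 u + occ 2 u + occ 3 u.
Proof.
elim: u => // x u IHu /andP[x4 /IHu]; rewrite !occ_cons /= => ->.
by move: x x4; apply: forall_lt4 => /=; lia.
Qed.

Lemma occ_progression w t0 t1 t2 :
  letters4 w -> t0 <= size w -> t1 <= size w -> t2 <= size w ->
  (forall c, occ c (take t0 w) + occ c (take t2 w) = 2 * occ c (take t1 w)) ->
  t0 + t2 = 2 * t1.
Proof.
move=> w4 le0 le1 le2 eq_occ.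
have sz t : t <= size w -> t = size (take t w).
  by move=> le_t; rewrite size_takel.
move: (sz _ le0) (sz _ le1) (sz _ le2).
rewrite !(size_occ (letters4_take _ w4)).
by move: (eq_occ 0) (eq_occ 1) (eq_occ 2) (eq_occ 3); clear; lia.
Qed.


(** * Keränen's substitution *)

Definition keranen_base : seq nat :=
  [:: 0; 1; 2; 0; 2; 3; 2; 1; 2; 3; 2; 0; 3; 2; 3; 1; 3; 0; 1; 0; 2; 0; 1; 0;
      3; 1; 0; 1; 2; 1; 3; 1; 2; 1; 0; 2; 1; 2; 3; 2; 0; 2; 1; 0; 1; 3; 0; 1;
      0; 2; 0; 3; 2; 1; 2; 3; 2; 0; 2; 3; 1; 2; 1; 0; 2; 1; 2; 3; 2; 0; 2; 3;
      2; 1; 3; 2; 3; 0; 3; 1; 3; 2; 1; 2; 0].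

(** The block of the letter [a] is the block of the letter 0 with all its
    letters shifted by [a] modulo 4. *)
Definition keranen (a : nat) : seq nat :=
  [seq (a + c) %% 4 | c <- keranen_base].

Definition keranen_image (w : seq nat) : seq nat := flatten (map keranen w).

Local Arguments Z.add : simpl never.
Local Arguments Z.mul : simpl never.
Arguments keranen : simpl never.
Arguments keranen_base : simpl never.

Lemma size_keranen a : size (keranen a) = 85.
Proof. by rewrite size_map. Qed.

Lemma letters4_keranen a : letters4 (keranen a).
Proof. by apply/allP=> x /mapP[c _ ->]; rewrite ltn_mod. Qed.

Lemma image_cons a w : keranen_image (a :: w) = keranen a ++ keranen_image w.
Proof. by []. Qed.

Lemma letters4_image w : letters4 (keranen_image w).
Proof.
apply/allP=> x /flattenP[_ /mapP[a _ ->]].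
exact: (allP (letters4_keranen a)).
Qed.

Lemma size_image w : size (keranen_image w) = 85 * size w.
Proof.
elim: w => // a w IHw.
by rewrite image_cons size_cat size_keranen IHw mulnS.
Qed.

Lemma occ_image c w :
  letters4 w ->
  occ c (keranen_image w) =
    occ 0 w * occ c (keranen 0) + occ 1 w * occ c (keranen 1) +
    occ 2 w * occ c (keranen 2) + occ 3 w * occ c (keranen 3).
Proof.
elim: w => // a w IHw /andP[a4 /IHw].
rewrite image_cons occ_cat !(occ_cons _ a w) => ->.
move: a a4; apply: forall_lt4;
  by do 4![move: (occ c (keranen _)) => ?]; rewrite /= ?add0n ?add1n; lia.
Qed.

Lemma image_cat u v :
  keranen_image (u ++ v) = keranen_image u ++ keranen_image v.
Proof. by rewrite /keranen_image map_cat flatten_cat. Qed.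

Lemma take_image q i w :
  q < size w -> i < 85 ->
  take (85 * q + i) (keranen_image w) =
    keranen_image (take q w) ++ take i (keranen (nth 0 w q)).
Proof.
move=> lt_q lt_i.
have -> : keranen_image w = keranen_image (take q w) ++
    (keranen (nth 0 w q) ++ keranen_image (drop q.+1 w)).
  by rewrite -image_cons -image_cat -drop_nth // cat_take_drop.
have sz_q : size (keranen_image (take q w)) = 85 * q.
  by rewrite size_image size_takel // ltnW.
rewrite takeD take_size_cat // drop_size_cat //.
by rewrite takel_cat // size_keranen ltnW.
Qed.

(** When [t] is the end of the image, its block is empty and the default
    letter 0 stands for the missing one. *)
Lemma occ_take_image c t w :
  letters4 w -> t <= size (keranen_image w) ->
  let q := t %/ 85 in let a := nth 0 w q in
  occ c (take t (keranen_image w)) =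
    occ c (keranen_image (take q w)) + occ c (take (t %% 85) (keranen a)).
Proof.
move=> w4 le_t q a; have def_t : t = 85 * q + t %% 85.
  by rewrite mulnC -divn_eq.
move: le_t; rewrite size_image => le_t; case: (ltnP q (size w)) => lt_q.
  by rewrite {1}def_t take_image ?ltn_mod // occ_cat.
have t0 : t = 85 * size w by have := ltn_mod t 85; lia.
rewrite (take_oversize lt_q) t0 take_oversize ?size_image // modnMr take0.
by rewrite addn0.
Qed.

(** * The two finite verifications *)

Definition weight_sum (wt : seq Z) (u : seq nat) : Z :=
  foldr (fun c z => (nth 0 wt c + z)%Z) 0%Z u.

(** The weights are the powers of 30176, a fourth root of unity modulo 43435
    at which the generating polynomial of the block of 0 vanishes.  The other
    blocks are its shifts, so the residue of every block is 0. *)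
Definition residue (u : seq nat) : Z :=
  (weight_sum [:: 1; 30176; 19636; 39101] u mod 43435)%Z.

(** The four letter counts as digits in base 1000. *)
Definition code (u : seq nat) : Z :=
  weight_sum [:: 1; 1000; 1000000; 1000000000]%Z u.

Definition cut (i a : nat) : Z * Z * Z :=
  let u := keranen a in (residue (take i u), code (take i u), code u).

Definition cut_row (i : nat) : seq (Z * Z * Z) := map (cut i) (iota 0 4).

Definition cut_rows : seq (seq (Z * Z * Z)) := [seq cut_row i | i <- iota 0 85].

(** For residues, both [x + z] and [2 * y] lie in the interval from 0 to
    [2 * 43435 - 1], so this is congruence modulo 43435, without divisions. *)
Definition cut_residues_match (x y z : Z) : bool :=
  let s := (x + z - 2 * y)%Z in
  [|| (s =? 0)%Z, (s =? 43435)%Z | (s =? -43435)%Z].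

(** Each of the three cuts moves to the left end of its block, or to the right
    end if the corresponding boolean holds; the letters that the cuts pass
    must not change the balance of letters. *)
Definition cut_shift (e0 e1 e2 : Z * Z * Z) (d0 d1 d2 : bool) : bool :=
  (e0.1.2 + e2.1.2 + 2 * (if d1 then e1.2 else 0) =?
   2 * e1.1.2 + (if d0 then e0.2 else 0) + (if d2 then e2.2 else 0))%Z.

(** A third cut at the left end of a block may be the end of the whole word,
    where there is no block to cross; [inner] says that it is not at the left
    end.  The first two cuts are never at the end of the word. *)
Definition cut_ok (inner : bool) (e0 e1 e2 : Z * Z * Z) : bool :=
  if cut_residues_match e0.1.1 e1.1.1 e2.1.1 then
    has (fun d0 => has (fun d1 => has (fun d2 => cut_shift e0 e1 e2 d0 d1 d2)
      (if inner then [:: false; true] else [:: false])) [:: false; true])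
      [:: false; true]
  else true.

(** The offsets are in arithmetic progression modulo 85, because the cuts are
    in arithmetic progression. *)
Definition cuts_ok (rows : seq (seq (Z * Z * Z))) : bool :=
  all (fun i1 => all (fun i0 =>
    let i2 := (i1 + i1 + 85 - i0) %% 85 in
    let r0 := nth [::] rows i0 in
    let r2 := nth [::] rows i2 in
    all (fun e1 => all (fun e0 => all (fun e2 =>
      cut_ok (i2 != 0) e0 e1 e2) r2) r0)
      (nth [::] rows i1)) (iota 0 85)) (iota 0 85).

(** [y] moves along a sequence that is split into the reversed part [l] before
    it and the part [r] after it, so that [zip] pairs the entries that are
    symmetric about [y]. *)
Fixpoint no_midpoint (l : seq Z) (y : Z) (r : seq Z) : bool :=
  all (fun p => ~~ (p.1 + p.2 =? 2 * y)%Z) (zip l r) &&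
  (if r is z :: r' then no_midpoint (y :: l) z r' else true).

Definition prefix_codes (u : seq nat) : seq Z :=
  [seq code (take i u) | i <- iota 0 (size u).+1].

Definition pairs_ok : bool :=
  all (fun x => all (fun y => (x == y) ||
    no_midpoint [::] 0%Z (behead (prefix_codes (keranen x ++ keranen y))))
    (iota 0 4)) (iota 0 4).

Lemma cuts_okT : cuts_ok cut_rows.
Proof. by vm_compute. Qed.

Lemma pairs_okT : pairs_ok.
Proof. by vm_compute. Qed.

Lemma weight_sum_cons wt x u :
  weight_sum wt (x :: u) = (nth 0 wt x + weight_sum wt u)%Z.
Proof. by []. Qed.

Lemma weight_sum_occ k0 k1 k2 k3 u :
  letters4 u ->
  weight_sum [:: k0; k1; k2; k3] u =
    (k0 * Z.of_nat (occ 0 u) + k1 * Z.of_nat (occ 1 u) +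
     k2 * Z.of_nat (occ 2 u) + k3 * Z.of_nat (occ 3 u))%Z.
Proof.
elim: u => [|x u IHu /andP[x4 /IHu IHu']]; first by rewrite /occ /=; lia.
rewrite !occ_cons weight_sum_cons IHu'.
rewrite -!plusE !Nat2Z.inj_add; do 4!move: (Z.of_nat (occ _ u)) => ?.
by move: x x4; apply: forall_lt4 => /=; ring.
Qed.

(** * Substitution preserves freeness from abelian squares *)

Lemma cuts_okP i0 i1 i2 a0 a1 a2 :
  i0 < 85 -> i1 < 85 -> i2 < 85 -> i0 + i2 = 2 * i1 %[mod 85] ->
  a0 < 4 -> a1 < 4 -> a2 < 4 ->
  cut_ok (i2 != 0) (cut i0 a0) (cut i1 a1) (cut i2 a2).
Proof.
move=> lt0 lt1 lt2 eq_i a04 a14 a24.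
have def_i2 : (i1 + i1 + 85 - i0) %% 85 = i2 by lia.
have mem_i i : i < 85 -> i \in iota 0 85 by rewrite mem_iota.
have nthr i : i < 85 -> nth [::] cut_rows i = cut_row i.
  by move=> lt_i; rewrite (nth_map 0) ?size_iota // nth_iota.
have in_row P i a : all P (cut_row i) -> a < 4 -> P (cut i a).
  by rewrite all_map => /allP row_P lt_a; apply: row_P; rewrite mem_iota.
move: cuts_okT => /allP/(_ i1 (mem_i _ lt1))/allP/(_ i0 (mem_i _ lt0)).
cbv zeta; rewrite def_i2 !nthr // => /in_row/(_ a14)/in_row/(_ a04) ok2.
exact: (in_row _ _ _ ok2 a24).
Qed.

Lemma no_midpointP l y r j n :
  no_midpoint l y r -> let s := rev l ++ y :: r in
  size l <= j -> 0 < n <= j -> j + n < size s ->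
  (nth 0 s (j - n) + nth 0 s (j + n) <> 2 * nth 0 s j)%Z.
Proof.
elim: r l y => [|z r IHr] l y.
  by move=> _ s lj n_j; rewrite size_cat size_rev /=; lia.
set r' := z :: r => ok_lr s lj n_j lt_s.
have /andP[ok next] : all (fun p => ~~ (p.1 + p.2 =? 2 * y)%Z) (zip l r') &&
  no_midpoint (y :: l) z r by exact: ok_lr.
have sz_s : size s = size l + (size r').+1 by rewrite size_cat size_rev.
case: (ltngtP (size l) j) lj => // [lt_j _|eq_j _].
  have := IHr (y :: l) z next.
  by rewrite rev_cons cat_rcons; apply.
have {}lt_s : n.-1 < size (zip l r').
  by rewrite size_zip; lia.
have /(all_nthP (0, 0)%Z)/(_ _ lt_s) := ok; rewrite nth_zip_cond lt_s /=.
move=> /negP neq eq_s; apply: neq; apply/Z.eqb_eq; move: eq_s.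
have -> : nth 0%Z s j = y by rewrite nth_cat size_rev -eq_j ltnn subnn.
have -> : nth 0%Z s (j + n) = nth 0%Z r' n.-1.
  rewrite nth_cat size_rev -eq_j ltnNge leq_addr /= addKn.
  by case: (n) n_j.
have -> // : nth 0%Z s (j - n) = nth 0%Z l n.-1.
have lt_l : j - n < size l by lia.
by rewrite nth_cat size_rev lt_l nth_rev //; congr nth; lia.
Qed.

(** The prefix codes at the three cuts of an abelian square would be in
    arithmetic progression, which [pairs_okT] excludes. *)
Lemma pairs_okP x y t0 t1 t2 :
  x < 4 -> y < 4 -> x != y -> ~ square_at (keranen x ++ keranen y) t0 t1 t2.
Proof.
move=> x4 y4 neq_xy; move def_u: (keranen x ++ keranen y) => u.
move=> [lt01 lt12 le2 eq_occ].
have u4 : letters4 u.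
  rewrite -def_u /letters4 all_cat.
  by apply/andP; split; apply: letters4_keranen.
have eq_t : t0 + t2 = 2 * t1.
  by apply: (occ_progression u4 _ _ le2 eq_occ); lia.
have eq_code : (code (take t0 u) + code (take t2 u) = 2 * code (take t1 u))%Z.
  rewrite /code !weight_sum_occ ?letters4_take //.
  by move: (eq_occ 0) (eq_occ 1) (eq_occ 2) (eq_occ 3); clear; lia.
have codeE t : t <= size u -> nth 0%Z (prefix_codes u) t = code (take t u).
  by move=> le_t; rewrite (nth_map 0) ?size_iota // nth_iota.
have mem4 a : a < 4 -> a \in iota 0 4 by rewrite mem_iota.
have /allP/(_ x (mem4 _ x4))/allP/(_ y (mem4 _ y4)) := pairs_okT.
rewrite (negPf neq_xy) def_u => no_mid.
have codesE : rev [::] ++ 0%Z :: behead (prefix_codes u) = prefix_codes u.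
  by rewrite /prefix_codes /= take0.
have n_t1 : 0 < t1 - t0 <= t1 by lia.
have := no_midpointP no_mid (leq0n t1) n_t1; rewrite codesE.
have -> : t1 - (t1 - t0) = t0 by lia.
have -> : t1 + (t1 - t0) = t2 by lia.
by rewrite size_map size_iota ltnS !codeE; lia.
Qed.

Definition zocc (c : nat) (u : seq nat) : Z := Z.of_nat (occ c u).

Lemma occ_keranenE :
  (occ 0 (keranen 0) = 19) * (occ 1 (keranen 0) = 21) *
  (occ 2 (keranen 0) = 27) * (occ 3 (keranen 0) = 18) *
  (occ 0 (keranen 1) = 18) * (occ 1 (keranen 1) = 19) *
  (occ 2 (keranen 1) = 21) * (occ 3 (keranen 1) = 27) *
  (occ 0 (keranen 2) = 27) * (occ 1 (keranen 2) = 18) *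
  (occ 2 (keranen 2) = 19) * (occ 3 (keranen 2) = 21) *
  (occ 0 (keranen 3) = 21) * (occ 1 (keranen 3) = 27) *
  (occ 2 (keranen 3) = 18) * (occ 3 (keranen 3) = 19).
Proof. by vm_compute. Qed.

(** In the balance of the three cuts, the complete blocks contribute an
    integral combination of the columns of the block matrix, on which the
    residue vanishes; hence the residues of the incomplete blocks balance. *)
Lemma cut_residuesP a0 a1 a2 i0 i1 i2 (x0 x1 x2 x3 : Z) :
  (forall c : nat, (c < 4)%N ->
    x0 * zocc c (keranen 0) + x1 * zocc c (keranen 1)
    + x2 * zocc c (keranen 2) + x3 * zocc c (keranen 3)
    + zocc c (take i0 (keranen a0)) + zocc c (take i2 (keranen a2))
    - 2 * zocc c (take i1 (keranen a1)) = 0)%Z ->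
  cut_residues_match (cut i0 a0).1.1 (cut i1 a1).1.1 (cut i2 a2).1.1.
Proof.
move=> eq_c; rewrite /cut /fst /residue.
rewrite !weight_sum_occ ?letters4_take ?letters4_keranen //.
move: (eq_c 0 isT) (eq_c 1 isT) (eq_c 2 isT) (eq_c 3 isT).
rewrite {eq_c}/zocc !occ_keranenE.
do 12![move: (Z.of_nat (occ _ (take _ _))) => ?].
set r0 := (_ mod _)%Z; set r1 := (_ mod _)%Z; set r2 := (_ mod _)%Z.
move=> e0 e1 e2 e3.
have : (r0 + r2 - 2 * r1 = 0 \/ r0 + r2 - 2 * r1 = 43435 \/
        r0 + r2 - 2 * r1 = -43435)%Z.
  by rewrite /r0 /r1 /r2; Z.div_mod_to_equations; lia.
by rewrite /cut_residues_match => [[->|[->|->]]].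
Qed.

Lemma digits_inj (x0 x1 x2 x3 y0 y1 y2 y3 : nat) :
  x0 < 1000 -> x1 < 1000 -> x2 < 1000 -> y0 < 1000 -> y1 < 1000 -> y2 < 1000 ->
  (1 * Z.of_nat x0 + 1000 * Z.of_nat x1 + 1000000 * Z.of_nat x2
   + 1000000000 * Z.of_nat x3 =
   1 * Z.of_nat y0 + 1000 * Z.of_nat y1 + 1000000 * Z.of_nat y2
   + 1000000000 * Z.of_nat y3)%Z ->
  [/\ x0 = y0, x1 = y1, x2 = y2 & x3 = y3].
Proof. by move=> *; split; lia. Qed.

(** All counts stay below 1000, so that equal codes mean equal counts. *)
Lemma cut_shiftP a0 a1 a2 i0 i1 i2 d0 d1 d2 c :
  cut_shift (cut i0 a0) (cut i1 a1) (cut i2 a2) d0 d1 d2 -> c < 4 ->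
  occ c (take i0 (keranen a0)) + occ c (take i2 (keranen a2))
    + 2 * (d1 * occ c (keranen a1)) =
  2 * occ c (take i1 (keranen a1)) + d0 * occ c (keranen a0)
    + d2 * occ c (keranen a2).
Proof.
have bnd e a : occ e (keranen a) <= 85 by rewrite -(size_keranen a) count_size.
have bnd_take i e a : occ e (take i (keranen a)) <= occ e (keranen a).
  by rewrite -{2}(cat_take_drop i (keranen a)) occ_cat leq_addr.
rewrite /cut_shift /cut /fst /snd /code => /Z.eqb_eq.
rewrite !weight_sum_occ ?letters4_take ?letters4_keranen //.
set L := fun e => occ e (take i0 (keranen a0)) + occ e (take i2 (keranen a2))
    + 2 * (d1 * occ e (keranen a1)).
set R := fun e => 2 * occ e (take i1 (keranen a1)) + d0 * occ e (keranen a0)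
    + d2 * occ e (keranen a2) => eq_code.
have L_lt e : L e < 1000.
  move: (bnd_take i0 e a0) (bnd_take i2 e a2) (bnd e a0) (bnd e a1) (bnd e a2).
  by rewrite /L; clear; case: d1; lia.
have R_lt e : R e < 1000.
  move: (bnd_take i1 e a1) (bnd e a0) (bnd e a1) (bnd e a2).
  by rewrite /R; clear; case: d0; case: d2; lia.
have [] : [/\ L 0 = R 0, L 1 = R 1, L 2 = R 2 & L 3 = R 3].
  apply: digits_inj => //; rewrite /L /R; clear -eq_code.
  by move: d0 d1 d2 eq_code => [] [] []; lia.
by move=> e0 e1 e2 e3; move: c; apply: forall_lt4.
Qed.

Lemma keranen_matrix_inj (y0 y1 y2 y3 : Z) :
  (forall c : nat, (c < 4)%N ->
    y0 * zocc c (keranen 0) + y1 * zocc c (keranen 1)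
    + y2 * zocc c (keranen 2) + y3 * zocc c (keranen 3) = 0)%Z ->
  [/\ y0 = 0, y1 = 0, y2 = 0 & y3 = 0]%Z.
Proof.
move=> eq_c; move: (eq_c 0 isT) (eq_c 1 isT) (eq_c 2 isT) (eq_c 3 isT).
by rewrite {eq_c}/zocc !occ_keranenE; split; lia.
Qed.

Lemma occ_keranen_letter a c :
  a < 4 -> zocc c (keranen a) =
    (Z.of_nat (a == 0)%N * zocc c (keranen 0)
     + Z.of_nat (a == 1)%N * zocc c (keranen 1)
     + Z.of_nat (a == 2)%N * zocc c (keranen 2)
     + Z.of_nat (a == 3)%N * zocc c (keranen 3))%Z.
Proof.
by move: a; apply: forall_lt4; rewrite [Z.of_nat (nat_of_bool _)]/=; lia.
Qed.

(** Two equal consecutive letters are already an abelian square of [w]; for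
    two distinct letters the computation [pairs_okT] applies.  If the block
    [q] is the last one, any other letter may follow. *)
Lemma square_in_pair w q t0 t1 t2 :
  letters4 w -> square_at (keranen_image w) t0 t1 t2 ->
  85 * q <= t0 -> t2 <= 85 * q.+2 -> exists s0 s1 s2, square_at w s0 s1 s2.
Proof.
move=> w4 [lt01 lt12 le2 eq_occ] le_q0 le_q2.
have lt_q : q < size w by rewrite size_image in le2; lia.
pose x := nth 0 w q.
pose y := if q.+1 < size w then nth 0 w q.+1 else x == 0.
have [eq_xy | neq_xy] := eqVneq x y.
  move: eq_xy; rewrite /y; case: ifP => [lt_q1 eq_xy | _]; last first.
    by case: (x).
  exists q, q.+1, q.+2; split=> // c.
  by rewrite !occ_takeS // -eq_xy -/x; lia.
have y4 : y < 4.
  by rewrite /y; case: ifP => _; [exact: letters4_nth | case: eqP].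
have split_take c t : 85 * q <= t -> t <= 85 * q.+2 -> t <= 85 * size w ->
    occ c (take t (keranen_image w)) = occ c (keranen_image (take q w)) +
      occ c (take (t - 85 * q) (keranen x ++ keranen y)).
  move=> le_qt le_tq2 le_tw; rewrite -occ_cat; congr occ.
  have sz_q : size (keranen_image (take q w)) = 85 * q.
    by rewrite size_image size_takel // ltnW.
  rewrite -{1}(cat_take_drop q w) image_cat -{1}(subnKC le_qt) takeD.
  rewrite take_size_cat ?drop_size_cat //; congr (_ ++ _).
  rewrite (drop_nth 0 lt_q) image_cons -/x /y.
  case: (ltnP q.+1 (size w)) => [lt_q1 | le_q1].
    rewrite (drop_nth 0 lt_q1) image_cons catA takel_cat //.
    by rewrite size_cat !size_keranen; lia.
  rewrite drop_oversize // cats0 takel_cat // size_keranen; lia.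
case: (@pairs_okP x y (t0 - 85 * q) (t1 - 85 * q) (t2 - 85 * q)) => //.
  exact: letters4_nth.
rewrite size_image in le2.
split; rewrite ?size_cat ?size_keranen; try lia.
by move=> c; have := eq_occ c; rewrite !split_take; lia.
Qed.

(** The positions [s t d] are the cuts moved to block boundaries, read as
    positions in [w].  Their balance [Y] is in the kernel of the block matrix,
    hence zero. *)
Lemma image_square w t0 t1 t2 :
  letters4 w -> square_at (keranen_image w) t0 t1 t2 ->
  exists s0 s1 s2, square_at w s0 s1 s2.
Proof.
move=> w4 sq; case: (sq) => lt01 lt12 le2 eq_occ.
have [le0 le1] : t0 <= size (keranen_image w) /\ t1 <= size (keranen_image w).
  by split; lia.
have sz_im := size_image w.
pose q t := t %/ 85; pose a t := nth 0 w (q t).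
pose r t := take (t %% 85) (keranen (a t)).
have a4 t : a t < 4 by exact: letters4_nth.
have im4 := letters4_image w.
have eq_t : t0 + t2 = 2 * t1 by apply: (occ_progression im4).
pose X b := (zocc b (take (q t0) w) + zocc b (take (q t2) w)
  - 2 * zocc b (take (q t1) w))%Z.
have eqX c : (X 0%N * zocc c (keranen 0) + X 1%N * zocc c (keranen 1)
    + X 2%N * zocc c (keranen 2) + X 3%N * zocc c (keranen 3)
    + zocc c (r t0) + zocc c (r t2) - 2 * zocc c (r t1) = 0)%Z.
  have := eq_occ c; rewrite !occ_take_image // -!/(q _) -!/(a _) -!/(r _).
  by rewrite !occ_image ?letters4_take // /X /zocc; lia.
have := @cuts_okP (t0 %% 85) (t1 %% 85) (t2 %% 85) (a t0) (a t1) (a t2).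
rewrite !ltn_mod !a4 => /(_ isT isT isT _ isT isT isT).
rewrite /cut_ok (cut_residuesP (fun c _ => eqX c)) => ok.
have {ok} [d0 [d1 [d2 [inner shift]]]] : exists d0 d1 d2 : bool,
    (d2 -> t2 %% 85 != 0) /\
    cut_shift (cut (t0 %% 85) (a t0)) (cut (t1 %% 85) (a t1))
              (cut (t2 %% 85) (a t2)) d0 d1 d2.
  have /hasP[d0 _ /hasP[d1 _ /hasP[d2 d2P shift]]] : _ := ok ltac:(lia).
  exists d0, d1, d2; split=> // d2T; move: d2P; rewrite d2T.
  by case: (t2 %% 85 != 0).
pose s t (d : bool) := q t + d.
have occ_s b t (d : bool) : t <= size (keranen_image w) ->
    (d -> t < size (keranen_image w)) ->
    zocc b (take (s t d) w) = (zocc b (take (q t) w) +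
      Z.of_nat d * Z.of_nat (a t == b)%N)%Z.
  move=> le_t; rewrite /s /zocc; case: d => [/(_ isT) lt_t|_]; last first.
    by rewrite addn0; lia.
  by rewrite addn1 occ_takeS -/(a t) /q; lia.
have lt0 : d0 -> t0 < size (keranen_image w) by move=> _; lia.
have lt1 : d1 -> t1 < size (keranen_image w) by move=> _; lia.
have lt2 : d2 -> t2 < size (keranen_image w) by move/inner; lia.
pose Y b := (zocc b (take (s t0 d0) w) + zocc b (take (s t2 d2) w)
  - 2 * zocc b (take (s t1 d1) w))%Z.
have [Y0 Y1 Y2 Y3] : [/\ Y 0%N = 0, Y 1%N = 0, Y 2%N = 0 & Y 3%N = 0]%Z.
  apply: keranen_matrix_inj => c c4; rewrite /Y !occ_s //.
  transitivity (X 0%N * zocc c (keranen 0) + X 1%N * zocc c (keranen 1)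
      + X 2%N * zocc c (keranen 2) + X 3%N * zocc c (keranen 3)
      + Z.of_nat d0 * zocc c (keranen (a t0))
      + Z.of_nat d2 * zocc c (keranen (a t2))
      - 2 * (Z.of_nat d1 * zocc c (keranen (a t1))))%Z.
    rewrite (occ_keranen_letter c (a4 t0)) (occ_keranen_letter c (a4 t1)).
    by rewrite (occ_keranen_letter c (a4 t2)) /X; ring.
  by have := cut_shiftP shift c4; have := eqX c; rewrite -!/(r _) /zocc; lia.
have eqY c : occ c (take (s t0 d0) w) + occ c (take (s t2 d2) w) =
    2 * occ c (take (s t1 d1) w).
  have [c4|le4c] := ltnP c 4; last by rewrite !occ_ge4 ?letters4_take.
  by move: c c4; apply: forall_lt4; move: Y0 Y1 Y2 Y3; rewrite /Y /zocc; lia.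
have le_s t (d : bool) : t <= size (keranen_image w) ->
    (d -> t < size (keranen_image w)) -> s t d <= size w.
  by rewrite sz_im /s /q; case: d => [? /(_ isT)|]; lia.
have eq_s : s t0 d0 + s t2 d2 = 2 * s t1 d1.
  by apply: (occ_progression w4 _ _ _ eqY); apply: le_s.
(* If the moved cuts do not advance, the original ones lie in two blocks. *)
have [lt_s | le_s10] := ltnP (s t0 d0) (s t1 d1).
  exists (s t0 d0), (s t1 d1), (s t2 d2); split=> //; first by lia.
  exact: le_s.
apply: (square_in_pair (q := q t0) w4 sq); first by rewrite /q; lia.
by move: le_s10 eq_s; rewrite /s /q; clear; case: d0; case: d1; case: d2; lia.
Qed.

Definition abelian_square_free (C : eqType) (w : seq C) : Prop :=
  forall u v x : seq C, w = u ++ v ++ x -> ~ anagram v.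

Lemma square_at_cat (u w1 w2 x : seq nat) :
  w1 != [::] -> perm_eq w1 w2 ->
  square_at (u ++ (w1 ++ w2) ++ x) (size u) (size u + size w1)
    (size u + size w1 + size w2).
Proof.
move=> nz_w1 eq_w; have sz : size w1 = size w2 := perm_size eq_w.
have pos_w1 : 0 < size w1 by rewrite lt0n size_eq0.
move def_w : (u ++ _) => w.
have def_w' : w = ((u ++ w1) ++ w2) ++ x by rewrite -def_w !catA.
split; try lia; first by rewrite def_w' !size_cat; lia.
have -> : take (size u) w = u by rewrite -def_w take_size_cat.
have -> : take (size u + size w1) w = u ++ w1.
  by rewrite def_w' -catA take_size_cat ?size_cat.
have -> : take (size u + size w1 + size w2) w = (u ++ w1) ++ w2.
  by rewrite def_w' take_size_cat ?size_cat.
have /permP eq_cnt := eq_w => c; have := eq_cnt (pred1 c).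
by rewrite !occ_cat -!/(occ c _); lia.
Qed.

Lemma abelian_square_square_at (w : seq nat) :
  (forall t0 t1 t2, ~ square_at w t0 t1 t2) -> abelian_square_free w.
Proof.
move=> no_sq u v x def_w [w1 [w2 [def_v /eqP nz_w1 eq_w]]].
rewrite {}def_w {}def_v in no_sq; exact: no_sq (square_at_cat u x nz_w1 eq_w).
Qed.

(** Iterates of the substitution on a single letter, which is too short to
    contain an abelian square. *)
Lemma ex_abelian_square_free n :
  exists w : seq nat, [/\ size w = n, letters4 w & abelian_square_free w].
Proof.
pose K k := iter k keranen_image [:: 0].
have K4 k : letters4 (K k) by case: k => // k; apply: letters4_image.
have K_free k t0 t1 t2 : ~ square_at (K k) t0 t1 t2.
  elim: k t0 t1 t2 => [|k IHk] t0 t1 t2.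
    by case=> lt01 lt12 /= le2 _; lia.
  by move/(image_square (K4 k)) => [s0 [s1 [s2]]]; exact: IHk.
have szK k : k < size (K k).
  by elim: k => //= k IHk; rewrite size_image; lia.
exists (take n (K n)); split; first by rewrite size_takel // ltnW.
  exact: letters4_take.
apply: abelian_square_square_at => t0 t1 t2 [lt01 lt12 le2 eq_occ].
have le2n : t2 <= n by move: le2; rewrite size_takel // ltnW.
have le2K : t2 <= size (K n) by rewrite (leq_trans le2n) // ltnW.
apply: (K_free n t0 t1 t2); split=> // c.
by move: (eq_occ c); rewrite !take_takel; lia.
Qed.

(** * Anagrams *)

Lemma anagram_map (C D : eqType) (g : C -> D) w :
  anagram w -> anagram (map g w).
Proof.
move=> [w1 [w2 [-> nz_w1 eq_w]]]; exists (map g w1), (map g w2); split.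
- by rewrite map_cat.
- by case: w1 nz_w1 {eq_w}.
exact: perm_map.
Qed.

Lemma anagram_rev (C : eqType) (w : seq C) : anagram w -> anagram (rev w).
Proof.
move=> [w1 [w2 [-> nz_w1 eq_w]]]; exists (rev w2), (rev w1); split.
- by rewrite rev_cat.
- move=> /(congr1 size); rewrite size_rev -(perm_size eq_w).
  by case: w1 nz_w1 {eq_w}.
by rewrite perm_sym perm_rev perm_sym perm_rev perm_sym.
Qed.

(** Restricting both halves to some of the letters keeps them permutations of
    each other. *)
Lemma anagram_filter (C : eqType) (a : pred C) (w : seq C) :
  has a w -> anagram w -> anagram (filter a w).
Proof.
move=> has_w [w1 [w2 [def_w _ eq_w]]]; exists (filter a w1), (filter a w2).
have eq_fw : perm_eq (filter a w1) (filter a w2) by apply: perm_filter.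
split=> //; first by rewrite def_w filter_cat.
move=> w1_0; move: has_w; rewrite has_filter def_w filter_cat w1_0.
by move: eq_fw; rewrite w1_0 perm_sym => /perm_nilP ->.
Qed.

Lemma anagram_size (C : eqType) (w : seq C) : anagram w -> 1 < size w.
Proof.
move=> [w1 [w2 [-> /eqP nz_w1 /perm_size eq_sz]]].
by rewrite size_cat -eq_sz; case: w1 nz_w1 {eq_sz} => //= x w1 _; rewrite addnS.
Qed.

(** * Paths in acyclic graphs *)

(** At the first vertex where two paths with the same ends part, follow the
    second one until it meets the first one again: both segments together
    form a cycle. *)
Lemma acyclic_path_inj (G : sgraph) (x : G) (p q : seq G) :
  acyclic_graph G -> path (@adj G) x p -> path (@adj G) x q ->
  uniq (x :: p) -> uniq (x :: q) -> last x p = last x q -> p = q.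
Proof.
move=> acG; elim: p x q => [|a p IHp] x [|b q] //=.
- by move=> _ _ _ /andP[/negP xq _] def_x; case: xq; rewrite def_x mem_last.
- by move=> _ _ /andP[/negP xp _] _ def_x; case: xp; rewrite -def_x mem_last.
move=> /andP[xa pa] /andP[xb qb] /andP[xp up] /andP[xq uq] eq_last.
have [eq_ab | neq_ab] := eqVneq a b.
  by rewrite eq_ab in pa up eq_last *; rewrite (IHp b q).
(* From here on [x] is the vertex where the paths part. *)
exfalso; pose P := a :: p; pose Q := b :: q.
have pP : path (@adj G) x P by rewrite /P /= xa.
have pQ : path (@adj G) x Q by rewrite /Q /= xb.
have uP : uniq (x :: P) by rewrite /P /= xp.
have uQ : uniq (x :: Q) by rewrite /Q /= xq.
have hasQ : has (mem P) Q.
  apply/hasP; exists (last b q); first exact: mem_last.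
  by rewrite -eq_last; apply: mem_last.
have [z [q1 [q2 [Pz noq1 def_Q]]]] : exists z, exists q1, exists q2,
    [/\ z \in P, ~~ has (mem P) q1 & Q = q1 ++ z :: q2].
  case: (split_find hasQ) => z q1 q2 Pz no1.
  by exists z, q1, q2; rewrite -cat_rcons.
have [p1 [p2 def_P]] : exists p1 p2, P = p1 ++ z :: p2.
  by case/splitPr: Pz => p1 p2; exists p1, p2.
(* the two segments from x to z close up into a cycle *)
have /acG : ucycle (@adj G) (x :: p1 ++ z :: rev q1).
  apply/andP; split.
    rewrite /= rcons_cat rcons_cons -cat_rcons cat_path last_rcons.
    have -> : path (@adj G) x (rcons p1 z).
      by move: pP; rewrite def_P -cat_rcons cat_path => /andP[].
    have : path (@adj G) x (rcons q1 z).
      by move: pQ; rewrite def_Q -cat_rcons cat_path => /andP[].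
    rewrite -(eq_path (e := fun u v => adj v u)) => [|u v]; last exact: adj_sym.
    by rewrite -rev_path last_rcons belast_rcons rev_cons.
  have sub1 : {subset p1 ++ [:: z] <= P}.
    by move=> y Py; rewrite def_P -cat_rcons mem_cat -cats1 Py.
  rewrite -cat_rcons -cats1 -cat_cons cat_uniq rev_uniq.
  have -> : uniq (x :: p1 ++ [:: z]).
    by move: uP; rewrite def_P -cat_rcons -cats1 -cat_cons cat_uniq => /andP[].
  have -> : uniq q1.
    by move: uQ; rewrite def_Q cons_uniq cat_uniq => /and4P[].
  rewrite andbT /= has_rev; apply/hasPn => y q1y.
  rewrite /= inE negb_or; apply/andP; split.
    apply/negP => /eqP def_y; move: uQ.
    by rewrite def_Q cons_uniq mem_cat -def_y q1y.
  by apply/negP => /sub1 Py; case/hasP: noq1; exists y.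
rewrite /= size_cat /= size_rev.
case: p1 def_P => [|? p1] def_P; last by rewrite /= addnS.
case: q1 {noq1} def_Q => [|? q1] def_Q; last by [].
by case: def_P def_Q neq_ab => -> _ [-> _]; rewrite eqxx.
Qed.

Lemma split_first_last (T : Type) (a : pred T) (s : seq T) :
  has a s -> exists s1 x m s2,
    [/\ s = s1 ++ (x :: m) ++ s2, a x, a (last x m), ~~ has a s1 & ~~ has a s2].
Proof.
elim: s => //= c s IHs; have [/IHs | no_s] := boolP (has a s); last first.
  by rewrite orbF => ac; exists [::], c, [::], s.
move=> [s1 [x [m [s2 [def_s ax al no1 no2]]]]] _.
have [ac | nac] := boolP (a c); last first.
  by exists (c :: s1), x, m, s2; split=> //=; rewrite ?def_s // negb_or nac.
exists [::], c, (s1 ++ x :: m), s2; split=> //=; last by rewrite last_cat.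
by rewrite def_s -catA.
Qed.

(** Between its first and its last vertex on [P], the path [s] has to follow
    [P], in one of the two directions, by uniqueness of paths. *)
Lemma acyclic_path_meet (G : sgraph) (P s : seq G) :
  acyclic_graph G -> uniq P -> sorted (@adj G) P ->
  uniq s -> sorted (@adj G) s ->
  exists l r, P = l ++ filter (mem P) s ++ r \/
              rev P = l ++ filter (mem P) s ++ r.
Proof.
move=> acG uP eP us es; have [hs | no_s] := boolP (has (mem P) s); last first.
  by exists [::], P; left; move: no_s; rewrite has_filter negbK => /eqP ->.
have [s1 [x [m [s2 [def_s Px Pl no1 no2]]]]] := split_first_last hs.
have -> : filter (mem P) s = filter (mem P) (x :: m).
  move: no1 no2; rewrite !has_filter !negbK => /eqP no1 /eqP no2.
  by rewrite def_s !filter_cat no1 no2 cats0.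
have um : uniq (x :: m).
  by move: us; rewrite def_s uniq_catCA cat_uniq => /and3P[].
have em : path (@adj G) x m.
  by move: es; rewrite def_s => /cat_sorted2[_ /cat_sorted2[]].
have core R : uniq R -> sorted (@adj G) R -> R =i P ->
    (exists l r, R = l ++ x :: r /\ last x m \in x :: r) ->
    exists l r, R = l ++ filter (mem P) (x :: m) ++ r.
  move=> uR eR eqRP [l [r' [def_R lr']]].
  have [t [r [def_r' eq_l]]] : exists t r, r' = t ++ r /\ last x t = last x m.
    by case/splitPl: lr' => t r; exists t, r.
  have ut : uniq (x :: t).
    move: uR; rewrite def_R def_r' uniq_catC -cat_cons -catA cat_uniq.
    by case/andP.
  have et : path (@adj G) x t.
    move: eR; rewrite def_R def_r' -cat_cons => /cat_sorted2[_ ].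
    by move=> /cat_sorted2[].
  have def_t : t = m by apply: acyclic_path_inj et em ut um eq_l.
  exists l, r; rewrite (_ : filter _ _ = x :: t) ?def_R ?def_r' //.
  rewrite -def_t; apply/all_filterP/allP => y ty.
  by rewrite /= -eqRP def_R def_r' -cat_cons !mem_cat ty orbT.
have [l [r def_P]] : exists l r, P = l ++ x :: r.
  by case/splitPr: Px => l r; exists l, r.
have [yr | nyr] := boolP (last x m \in x :: r).
  have [//||l' [r' def_P']] := core P uP eP; first by exists l, r.
  by exists l', r'; left.
have [||||l' [r' def_rP]] := core (rev P).
- by rewrite rev_uniq.
- rewrite rev_sorted (eq_sorted (e' := @adj G)) // => u v; exact: adj_sym.
- exact: mem_rev.
- exists (rev r), (rev l); rewrite def_P rev_cat rev_cons cat_rcons; split=> //.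
  move: Pl nyr; rewrite /= def_P mem_cat => /orP[lP _|->//].
  by rewrite inE mem_rev lP orbT.
by exists l', r'; right.
Qed.

(** * Paths and path decompositions *)

(** Neighbours share a bag, so that a path cannot jump over a bag. *)
Lemma path_hits_bag (G : sgraph) (B : seq {set G}) a p i j l :
  path_decomposition B -> path (@adj G) a p ->
  a \in nth set0 B i -> last a p \in nth set0 B j ->
  i <= l <= j -> j < size B ->
  exists2 y, y \in a :: p & y \in nth set0 B l.
Proof.
move=> [_ edgeB intB]; elim: p a i => [|c p IHp] a i /=.
  move=> _ ai aj lij ltj; exists a; first exact: mem_head.
  exact: intB lij ltj ai aj.
move=> /andP[ac pc] ai cj /andP[il lj] ltj.
have [b Bb /andP[ab cb]] := edgeB _ _ ac.
pose m := index b B; have ltm : m < size B by rewrite index_mem.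
have bm : nth set0 B m = b by apply: nth_index.
have [le_lm | lt_ml] := leqP l m.
  exists a; first exact: mem_head.
  by apply: (intB a i l m); rewrite ?il ?bm.
have [y yp yl] : exists2 y, y \in c :: p & y \in nth set0 B l.
  by apply: (IHp c m) => //; rewrite ?bm // ltnW.
by exists y; rewrite // inE yp orbT.
Qed.

Definition induced_rel (G : sgraph) (S : {set G}) : rel G :=
  fun u v => [&& adj u v, u \in S & v \in S].

Lemma induced_rel_sym (G : sgraph) (S : {set G}) : symmetric (induced_rel S).
Proof.
by move=> u v; rewrite /induced_rel adj_sym; congr (_ && _); apply: andbC.
Qed.

Lemma connect_induced (G : sgraph) (S : {set G}) x y :
  connect (induced_rel S) x y -> x \in S -> y \in S.
Proof.
move=> cxy xS; rewrite -(closed_connect _ cxy) // => u v /and3P[_ uS vS].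
by rewrite uS vS.
Qed.

(** Join a vertex in the first bag that the component of [x] in [S] meets to a
    vertex in the last such bag. *)
Lemma ex_hitting_path (G : sgraph) (B : seq {set G}) (S : {set G}) x :
  path_decomposition B -> x \in S ->
  exists P : seq G, [/\ uniq P, sorted (@adj G) P
    & forall b y, b \in B -> y \in b -> connect (induced_rel S) x y ->
        exists2 z, z \in P & (z \in b) && connect (induced_rel S) x z].
Proof.
move=> pdB xS; case: (pdB) => coverB _ _; set e := induced_rel S.
pose meets i :=
  (i < size B) && [exists y, (y \in nth set0 B i) && connect e x y].
have meetsP i b y :
    b \in B -> y \in b -> connect e x y -> i = index b B -> meets i.
  move=> Bb yb cxy ->; rewrite /meets index_mem Bb; apply/existsP; exists y.
  by rewrite nth_index // yb.
have ex_meets : exists i, meets i.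
  have [b Bb xb] := coverB x; exists (index b B).
  by apply: (meetsP _ b x) => //; apply: connect0.
have le_meets i : meets i -> i <= size B by case/andP=> /ltnW.
have [i /andP[lti /existsP[a /andP[ai cxa]]] min_i] := ex_minnP ex_meets.
have [j /andP[ltj /existsP[c /andP[cj cxc]]] max_j] :=
  ex_maxnP ex_meets le_meets.
have csym : connect_sym e by apply: sym_connect_sym; apply: induced_rel_sym.
have /connectP[p0 ep0 def_c] : connect e a c.
  by rewrite (connect_trans _ cxc) // csym.
case: (shortenP ep0) def_c => p ep up _ def_c.
have eG : path (@adj G) a p by apply: sub_path ep => u v /and3P[].
exists (a :: p); split=> // b y Bb yb cxy.
have mb : meets (index b B) by apply: (meetsP _ b y).
have [|||z zp zb] := @path_hits_bag G B a p i j (index b B) pdB eG ai.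
- by rewrite -def_c.
- by rewrite min_i // max_j.
- by [].
exists z => //; rewrite nth_index // in zb; rewrite zb /=.
exact: connect_trans cxa (path_connect ep zp).
Qed.

(** * Colouring with four colours per unit of pathwidth *)

(** Writes the word [w] along the path [P]. *)
Definition path_word (G : sgraph) (w : seq nat) (P : seq G) (x : G) : nat :=
  nth 0 w (index x P).

Lemma map_path_word (G : sgraph) (w : seq nat) (P : seq G) :
  uniq P -> size P <= size w -> map (path_word w P) P = take (size P) w.
Proof.
move=> uP le_Pw; apply: (@eq_from_nth _ 0).
  by rewrite size_map size_takel.
move=> i; rewrite size_map => lt_i.
case: P uP le_Pw lt_i => // x P uP le_Pw lt_i.
by rewrite (nth_map x) // nth_take // /path_word index_uniq.
Qed.

Lemma path_word_free (G : sgraph) (w : seq nat) (P s : seq G) :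
  acyclic_graph G -> abelian_square_free w -> size P <= size w ->
  uniq P -> sorted (@adj G) P -> uniq s -> sorted (@adj G) s ->
  ~ anagram (map (path_word w P) (filter (mem P) s)).
Proof.
move=> acG w_free le_Pw uP eP us es.
have [l [r def_P]] := acyclic_path_meet acG uP eP us es.
move: (filter _ _) def_P => t def_P.
have free_in l' t' r' :
    P = l' ++ t' ++ r' -> ~ anagram (map (path_word w P) t').
  move=> def_P' ana; pose wP := map (path_word w P).
  apply: (w_free (wP l') (wP t') (wP r' ++ drop (size P) w)) ana.
  rewrite -[LHS](cat_take_drop (size P)) -map_path_word // !catA -!map_cat.
  by rewrite -catA -def_P'.
case: def_P => [def_P | def_rP]; first exact: free_in def_P.
move/anagram_rev; rewrite -map_rev; apply: (free_in (rev r) _ (rev l)).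
by rewrite -[LHS]revK def_rP !rev_cat catA.
Qed.

(** [P x] is the path removed from the component of [x]; it is chosen through
    [root], so that all vertices of a component agree on it. *)
Lemma colour_set (G : sgraph) (B : seq {set G}) k (S : {set G}) :
  acyclic_graph G -> path_decomposition B ->
  (forall b, b \in B -> #|b :&: S| <= k.+1) ->
  exists f : G -> nat, (forall x, f x < (4 * k).+1) /\
    forall s, is_path s -> {subset s <= S} -> ~ anagram (map f s).
Proof.
move=> acG pdB; elim: k S => [|k IHk] S le_bS.
  exists (fun=> 0); split=> // s /and3P[_ us es] sS /anagram_size.
  case: s us es sS => [|u [|v s]] //= /andP[]; rewrite inE negb_or.
  move=> /andP[neq_uv _] _ /andP[uv _] sS _.
  have [_ edgeB _] := pdB; have [b Bb /andP[ub vb]] := edgeB _ _ uv.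
  suff: 1 < #|b :&: S| by rewrite ltnNge le_bS.
  apply: (@leq_trans #|[set u; v]|); first by rewrite cards2 neq_uv.
  apply: subset_leq_card; apply/subsetP=> x; rewrite !inE => /orP[]/eqP->.
    by rewrite ub sS ?mem_head.
  by rewrite vb sS // inE mem_head orbT.
set e := induced_rel S.
have csym : connect_sym e by apply: sym_connect_sym; apply: induced_rel_sym.
have exP x : exists P : seq G, x \in S ->
    [/\ uniq P, sorted (@adj G) P
    & forall b y, b \in B -> y \in b -> connect e x y ->
        exists2 z, z \in P & (z \in b) && connect e x z].
  have [xS | _] := boolP (x \in S); last by exists [::].
  by have [P ?] := ex_hitting_path pdB xS; exists P.
have [P0 P0P] := fin_all_exists exP.
pose P x := P0 (root e x).
have PE x y : connect e x y -> P x = P y.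
  by move/(rootP csym) => eq_r; rewrite /P eq_r.
have rootS x : x \in S -> root e x \in S.
  exact: connect_induced (connect_root _ _).
pose S' := [set x in S | x \notin P x].
have subS' : S' \subset S by apply/subsetP=> x; rewrite inE => /andP[].
have le_bS' b : b \in B -> #|b :&: S'| <= k.+1.
  move=> Bb; have [bS0 | [y]] := set_0Vmem (b :&: S).
    by rewrite (leq_trans (subset_leq_card (setIS b subS'))) // bS0 cards0.
  rewrite inE => /andP[yb yS]; rewrite -ltnS (leq_trans _ (le_bS b Bb)) //.
  have [_ _ hit] := P0P _ (rootS y yS).
  have [|z zP /andP[zb cz]] := hit b y Bb yb.
    by rewrite csym connect_root.
  apply: proper_card; apply/properP; split.
    exact: setIS.
  have cyz : connect e y z by apply: connect_trans cz; apply: connect_root.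
  exists z; first by rewrite inE zb (connect_induced cyz).
  by rewrite !inE -(PE _ _ cyz) zP !andbF.
have [f' [f'_lt f'_free]] := IHk S' le_bS'.
have [w [szw w4 w_free]] := ex_abelian_square_free #|G|.
pose f x := if x \in P x then (4 * k).+1 + path_word w (P x) x else f' x.
exists f; split=> [x|s ps sS].
  rewrite /f /path_word; case: ifP => _; last first.
    by rewrite (leq_trans (f'_lt x)) //; lia.
  by have := letters4_nth (index x (P x)) w4; lia.
have /and3P[] := ps; case: s ps sS => // h s ps sS _ us es.
have hS : h \in S by apply: sS; apply: mem_head.
have eh : path e h s.
  apply: (sub_in_path (P := mem S)) es; last exact/allP.
  by move=> u v uS vS uv; apply/and3P.
have PsE x : x \in h :: s -> P x = P h.
  by move=> xs; apply/esym/PE; apply: (path_connect eh).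
have [uP eP _] := P0P _ (rootS h hS); rewrite -/(P h) in uP eP.
have [meetP | noP] := boolP (has (mem (P h)) (h :: s)); last first.
  have notP x : x \in h :: s -> x \notin P h.
    by move=> xs; apply: (hasPn noP x xs).
  have fE : map f (h :: s) = map f' (h :: s).
    apply/eq_in_map => x xs; rewrite /f PsE //.
    by rewrite (negPf (notP x xs)).
  rewrite fE; apply: f'_free => // x xs; rewrite inE sS // PsE //.
  exact: notP.
have f_Ph x : x \in h :: s -> ((4 * k).+1 <= f x) = (x \in P h).
  move=> xs; rewrite /f PsE //; case: ifP => _; first exact: leq_addr.
  by apply/negbTE; rewrite -ltnNge.
(* The fresh colours are those from [4 * k + 1] on; subtracting this offset
   from the part of [s] on the removed path gives back letters of [w]. *)
move=> ana.
pose t := filter (mem (P h)) (h :: s).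
have {ana} /(anagram_map (subn^~ (4 * k).+1)) : anagram (map f t).
  have -> : t = filter (preim f (leq (4 * k).+1)) (h :: s).
    by apply: eq_in_filter => x xs; rewrite /= f_Ph.
  rewrite -filter_map; apply: anagram_filter => //.
  case/hasP: meetP => x xs xP; rewrite has_map; apply/hasP; exists x => //.
  by rewrite /= f_Ph.
rewrite -map_comp (_ : map _ t = map (path_word w (P h)) t).
  by apply: path_word_free => //; rewrite szw -(card_uniqP uP) max_card.
apply/eq_in_map => x; rewrite mem_filter => /andP[/= xP xs].
by rewrite /f PsE // xP addKn.
Qed.

Lemma leq_bag_pd_width (G : sgraph) (B : seq {set G}) b :
  b \in B -> #|b| <= (pd_width B).+1.
Proof.
move=> Bb; apply: leq_trans (leqSpred _).
exact: (leq_bigmax_seq (F := fun b : {set G} => #|b|)).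
Qed.

Lemma phi_le_pathwidth (T : sgraph) :
  acyclic_graph T -> phi T <= 4 * pathwidth T + 1.
Proof.
move=> acT; rewrite /pathwidth.
case: ex_minnP => k /boolp.asboolP[B pdB def_k] _.
have [b Bb|f [f_lt f_free]] := @colour_set T B k [set: T] acT pdB.
  by rewrite setIT -def_k; exact: leq_bag_pd_width.
rewrite /phi; case: ex_minnP => m _; apply; apply/boolp.asboolP; rewrite addn1.
exists (fun x => Ordinal (f_lt x)) => s ps ana.
apply: (f_free s ps); first by move=> x _; rewrite inE.
by have := anagram_map val ana; rewrite -map_comp.
Qed.

(** * Complete d-ary trees *)

(** Numbering each level from left to right makes the parent of the vertex [m]
    of a level the vertex [m %/ d] of the level above. *)
Definition dary_vertex (d h : nat) : finType :=
  {x : 'I_h.+1 * 'I_(d ^ h) | x.2 < d ^ x.1}.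

Definition level d h (x : dary_vertex d h) : nat := (val x).1.
Definition pos d h (x : dary_vertex d h) : nat := (val x).2.

Lemma vertex_inj d h (x y : dary_vertex d h) :
  level x = level y -> pos x = pos y -> x = y.
Proof.
move=> eq_l eq_m; apply/val_inj; rewrite [val x]surjective_pairing.
by rewrite [val y]surjective_pairing; congr (_, _); apply: val_inj.
Qed.

Lemma pos_lt d h (x : dary_vertex d h) : pos x < d ^ level x.
Proof. exact: (valP x). Qed.

Lemma level_le d h (x : dary_vertex d h) : level x <= h.
Proof. by rewrite -ltnS ltn_ord. Qed.

Lemma ex_vertex d h l m :
  0 < d -> l <= h -> m < d ^ l ->
  exists x : dary_vertex d h, level x = l /\ pos x = m.
Proof.
move=> d0 le_l lt_m; have lt_l : l < h.+1 by [].
have lt_mh : m < d ^ h by apply: leq_trans lt_m (leq_pexp2l d0 le_l).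
by exists (Sub (Ordinal lt_l, Ordinal lt_mh) lt_m); rewrite /level /pos SubK.
Qed.

Definition child d h (x y : dary_vertex d h) : bool :=
  (level x == (level y).+1) && (pos x %/ d == pos y).

Lemma child_inj d h (x y z : dary_vertex d h) : child x y -> child x z -> y = z.
Proof.
move=> /andP[/eqP xy /eqP mxy] /andP[/eqP xz /eqP mxz].
by apply: vertex_inj; lia.
Qed.

Definition dary_adj d h : rel (dary_vertex d h) :=
  fun x y => child x y || child y x.

Lemma dary_adj_sym d h : symmetric (@dary_adj d h).
Proof. by move=> x y; apply: orbC. Qed.

Lemma dary_adj_irrefl d h : irreflexive (@dary_adj d h).
Proof. by move=> x; rewrite /dary_adj /child orbb ltn_eqF. Qed.

Definition dary_tree (d h : nat) : sgraph :=
  SGraph (@dary_adj_sym d h) (@dary_adj_irrefl d h).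

Lemma dary_tree_connected d h : 0 < d -> connected_graph (dary_tree d h).
Proof.
move=> d0; have [r [lr _]] := @ex_vertex d h 0 0 d0 isT isT.
split; first by apply/card_gt0P; exists r.
have csym : connect_sym (@adj (dary_tree d h)) by apply/sym_connect_sym/adj_sym.
suff root_x n (x : dary_tree d h) :
    level x = n -> connect (@adj (dary_tree d h)) x r.
  move=> x y; apply: (connect_trans (root_x _ x erefl)).
  by rewrite csym; apply: root_x.
elim: n x => [|n IHn] x lx.
  rewrite (@vertex_inj d h x r) //; first by rewrite lr.
  move: (pos_lt x) (pos_lt r); rewrite lr lx expn0 !ltnS !leqn0.
  by move=> /eqP-> /eqP->.
have [||y [ly my]] := @ex_vertex d h n (pos x %/ d) d0.
- by have := level_le x; lia.
- by rewrite ltn_divLR // -expnSr -lx pos_lt.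
apply: connect_trans (IHn y ly); apply: connect1.
by rewrite /= /dary_adj /child lx ly my !eqxx.
Qed.

(** Both neighbours on a cycle of a vertex of largest level would be the
    parent of that vertex. *)
Lemma dary_tree_acyclic d h : acyclic_graph (dary_tree d h).
Proof.
move=> c /andP[ec uc]; rewrite ltnNge; apply/negP => sz_c.
have [x0 x0c] : exists x, x \in c.
  by case: c sz_c {ec uc} => // x c; exists x; rewrite mem_head.
have [x xc max_x] := @arg_maxnP _ x0 (mem c) (@level d h) x0c.
have [i c' def_c] := rot_to xc.
move: ec uc sz_c; rewrite -(rot_cycle i) -(rot_uniq i) -(size_rot i) def_c.
have {}max_x y : y \in x :: c' -> level y <= level x.
  by rewrite -def_c mem_rot; apply: max_x.
case: c' {def_c} max_x => [|y c'] // max_x.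
case/lastP: c' max_x => [|c' z] // max_x.
have up u : u \in x :: y :: rcons c' z -> dary_adj x u -> child x u.
  by move=> /max_x le_u /orP[//|/andP[/eqP]]; lia.
rewrite /= rcons_path last_rcons => /and3P[xy _ zx] /and3P[_ yz _] _.
have cy : child x y by apply: up => //; rewrite !inE eqxx orbT.
have cz : child x z.
  by apply: up; rewrite 1?dary_adj_sym // !inE mem_rcons mem_head !orbT.
by case/negP: yz; rewrite (child_inj cy cz) mem_rcons mem_head.
Qed.

(** The bag of the leaf [n] is its path to the root.  The leaves below a vertex
    form an interval because division by a power of [d] is monotone. *)
Lemma pathwidth_dary_tree d h : 0 < d -> pathwidth (dary_tree d h) <= h.
Proof.
move=> d0.
pose bag n := [set v : dary_tree d h | n %/ d ^ (h - level v) == pos v].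
pose B := [seq bag n | n <- iota 0 (d ^ h)].
have szB : size B = d ^ h by rewrite size_map size_iota.
have nthB i : i < d ^ h -> nth set0 B i = bag i.
  by move=> lt_i; rewrite (nth_map 0) ?size_iota // nth_iota.
have ex_bag (v : dary_tree d h) : exists2 n, n < d ^ h & v \in bag n.
  exists (pos v * d ^ (h - level v)); last first.
    by rewrite inE mulnK // expn_gt0 d0.
  have -> : d ^ h = d ^ level v * d ^ (h - level v).
    by rewrite -expnD subnKC // level_le.
  rewrite ltn_pmul2r ?pos_lt //.
  by rewrite expn_gt0 d0.
have mem_bag n : n < d ^ h -> bag n \in B.
  by move=> lt_n; rewrite map_f // mem_iota.
have child_bag u v n : child u v -> u \in bag n -> v \in bag n.
  move=> /andP[/eqP lu /eqP mu]; rewrite !inE -mu => /eqP <-.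
  have := level_le u; rewrite lu => lt_v.
  by rewrite -divnMA -expnSr; apply/eqP; congr (_ %/ d ^ _); lia.
have pdB : path_decomposition B.
  split=> [v|u v|v i j k /andP[le_ij le_jk]].
  - by have [n lt_n vn] := ex_bag v; exists (bag n); rewrite ?mem_bag.
  - case/orP=> uv.
      have [n lt_n un] := ex_bag u; exists (bag n); first exact: mem_bag.
      by rewrite un (child_bag u).
    have [n lt_n vn] := ex_bag v; exists (bag n); first exact: mem_bag.
    by rewrite vn (child_bag v).
  rewrite szB => lt_k; have lt_j := leq_ltn_trans le_jk lt_k.
  rewrite !nthB // ?(leq_ltn_trans le_ij) // !inE => /eqP iv /eqP kv.
  by rewrite eqn_leq -{1}kv -iv !leq_div2r.
rewrite /pathwidth; case: ex_minnP => k _ min_k.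
apply: (@leq_trans (pd_width B)).
  by apply: min_k; apply/boolp.asboolP; exists B.
suff: \max_(b <- B) #|b| <= h.+1 by rewrite /pd_width; case: (\max_(_ <- _) _).
apply/bigmax_leqP_seq => b /mapP[n _ ->] _.
have inj_l : {in bag n &, injective (fun v : dary_tree d h => (val v).1)}.
  move=> u v; rewrite !inE => /eqP un /eqP vn /(congr1 val) luv.
  by apply: vertex_inj; rewrite // -un -vn /level luv.
by rewrite -(card_in_imset inj_l) (leq_trans (max_card _)) // card_ord.
Qed.

(** * Anagrams in coloured complete d-ary trees *)

Lemma sorted_rev_cat (T : Type) (e : rel T) u p q :
  symmetric e -> path e u p -> path e u q -> sorted e (rev p ++ u :: q).
Proof.
move=> sym_e; elim/last_ind: p => [|p z IHp] //.
rewrite rcons_path rev_rcons /=.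
move=> /andP[/IHp pq uz] /pq; case/lastP: p {pq IHp} uz => [|p y] /=.
  by move=> uz ->; rewrite sym_e uz.
by rewrite last_rcons rev_rcons /= sym_e => -> ->.
Qed.

Definition descends d h : rel (dary_vertex d h) := fun u v => child v u.
Arguments descends {d h}.

(** [a] is [v] or an ancestor of [v]. *)
Definition below d h (v a : dary_vertex d h) : bool :=
  (level a <= level v) && (pos v %/ d ^ (level v - level a) == pos a).

Lemma descends_below d h (a v : dary_vertex d h) s :
  path descends a s -> v \in a :: s -> below v a.
Proof.
elim/last_ind: s v => [|s z IHs] v.
  by rewrite inE => _ /eqP->; rewrite /below leqnn subnn divn1 eqxx.
rewrite rcons_path -rcons_cons mem_rcons => /andP[ps].
case/andP=> /eqP lz /eqP mz; rewrite inE => /predU1P[->|]; last exact: IHs.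
have /andP[le_a /eqP eq_a] := IHs _ ps (mem_last a s).
rewrite /below lz (leq_trans le_a) //= subSn // expnS divnMA mz.
exact/eqP.
Qed.

Lemma descends_uniq d h (a : dary_vertex d h) s :
  path descends a s -> uniq (a :: s).
Proof.
move=> ps; apply: (@map_uniq _ _ (@level d h)).
apply: (sorted_uniq ltn_trans ltnn); rewrite /= path_map.
by apply: sub_path ps => x y /andP[/eqP yx _]; rewrite /= yx.
Qed.

(** [u] is the root of a complete binary subtree in which the levels have the
    colours [cs], from the top down. *)
Fixpoint level_mono d h (C : eqType) (f : dary_vertex d h -> C)
    (u : dary_vertex d h) (cs : seq C) : Prop :=
  if cs is c :: cs' then
    f u = c /\ (cs' = [::] \/ exists a b,
      [/\ a != b, child a u, child b u,
          level_mono f a cs' & level_mono f b cs'])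
  else True.

(** By induction each of the [d] children of [u] is the root of such a subtree;
    there are fewer than [d] colour sequences, hence two children share one. *)
Lemma ex_level_mono d h k (f : dary_vertex d h -> 'I_k) n u :
  (forall m, m <= h -> k ^ m < d) -> level u + n = h ->
  exists cs : n.+1.-tuple 'I_k, level_mono f u cs.
Proof.
move=> lt_d; elim: n u => [|n IHn] u lu.
  by exists [tuple f u]; split; [|left].
have d0 : 0 < d by apply: leq_ltn_trans (lt_d 0 _).
have child_i (i : 'I_d) :
    exists v : dary_vertex d h, child v u /\ pos v = pos u * d + i.
  have [||v [lv mv]] := @ex_vertex d h (level u).+1 (pos u * d + i) d0.
  - by lia.
  - rewrite expnSr (@leq_trans ((pos u).+1 * d)) //.
      by rewrite mulSnr ltn_add2l.
    by rewrite leq_pmul2r ?pos_lt.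
  by exists v; rewrite /child lv mv divnMDl // divn_small // addn0 !eqxx.
have [v vP] := fin_all_exists child_i.
have ex_t (i : 'I_d) : exists t : n.+1.-tuple 'I_k, level_mono f (v i) t.
  by apply: IHn; have [/andP[/eqP -> _] _] := vP i; lia.
have [t tP] := fin_all_exists ex_t.
have /injectivePn[i [j neq_ij eq_t]] : ~~ injectiveb t.
  apply/injectiveP => /leq_card; rewrite card_tuple !card_ord leqNgt.
  by rewrite lt_d //; lia.
exists [tuple of f u :: t i]; split=> //; right; exists (v i), (v j).
have [[ci pi] [cj pj]] := (vP i, vP j); split=> //; last by rewrite eq_t.
apply: contraNneq neq_ij => eq_v; apply/eqP/val_inj.
by move: pi pj; rewrite eq_v => -> /addnI.
Qed.

Lemma level_mono_drop d h (C : eqType) (f : dary_vertex d h -> C) u cs i :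
  level_mono f u cs -> i < size cs -> exists v, level_mono f v (drop i cs).
Proof.
elim: cs u i => // c cs IHcs u [|i] mono_u /=; first by exists u.
case: mono_u => _ [-> //|[a [_ [_ _ _ mono_a _]]]].
exact: IHcs mono_a.
Qed.

Lemma level_mono_path d h (C : eqType) (f : dary_vertex d h -> C) u cs n :
  level_mono f u cs -> n < size cs ->
  exists2 s, path descends u s & map f (u :: s) = take n.+1 cs.
Proof.
elim: cs u n => // c cs IHcs u n [fu next] lt_n.
case: n lt_n => [|n] lt_n; first by exists [::]; rewrite //= fu take0.
case: next lt_n => [-> //|[a [_ [_ au _ mono_a _]]]] lt_n.
have [s ps fs] := IHcs a n mono_a lt_n.
by exists (a :: s); rewrite /= ?[descends u a]au // fu -fs.
Qed.

(** Levels [i < j] of the same colour would give an anagram: the path from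
    level [j - 1] up to [v] on level [i] and down the other branch to level
    [j].  Its halves are the part up to [v], and the part below [v]. *)
Lemma level_mono_uniq d h (C : eqType) (f : dary_tree d h -> C) u cs :
  anagram_free f -> level_mono f u cs -> uniq cs.
Proof.
move=> f_free; case: cs => // c0 cs0; set cs := c0 :: cs0 => mono_u.
apply/negPn/negP => /(uniqPn c0)[i [j [lt_ij lt_j eq_c]]].
have [v] := level_mono_drop mono_u (ltn_trans lt_ij lt_j).
rewrite (drop_nth c0) ?(ltn_trans lt_ij) // => -[fv].
set cs' := drop i.+1 cs; pose m := j - i.+1.
have lt_m : m < size cs' by rewrite size_drop; lia.
have cm : nth c0 cs' m = f v by rewrite nth_drop subnKC // fv eq_c.
case=> [cs'0|[a [b [neq_ab av bv mono_a mono_b]]]].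
  by rewrite cs'0 in lt_m.
have [sa pa fa] := level_mono_path mono_a lt_m.
have [sb pb fb] := level_mono_path mono_b lt_m.
have sub_b : {subset take m (b :: sb) <= b :: sb} by move=> x /mem_take.
have dva : path descends v (a :: sa) by rewrite /= [descends v a]av.
have dvb : path descends v (b :: sb) by rewrite /= [descends v b]bv.
have adj_d : subrel (@descends d h) (@adj (dary_tree d h)).
  by move=> x y xy; apply/orP; right.
pose s : seq (dary_tree d h) := rev (take m (b :: sb)) ++ v :: a :: sa.
apply: (f_free s).
  apply/and3P; split; first by rewrite /s; case: (rev _).
    have /= /andP[vb ub] := descends_uniq dvb.
    rewrite cat_uniq rev_uniq take_uniq // (descends_uniq dva) andbT.
    rewrite has_sym has_rev.
    apply/hasPn => x /sub_b bx; rewrite /= inE negb_or; apply/andP; split.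
      by apply: contraNneq vb => <-.
    apply/negP => /(descends_below pa)/andP[_ /eqP xa].
    have /andP[_ /eqP xb] := descends_below pb bx.
    case/negP: neq_ab; apply/eqP.
    move: av bv => /andP[/eqP la _] /andP[/eqP lb _].
    by apply: vertex_inj; rewrite -?xa -?xb la lb.
  apply: sorted_rev_cat; [exact: adj_sym | | exact: sub_path dva].
  by apply: take_path; apply: sub_path dvb.
exists (rev (take m cs') ++ [:: f v]), (take m cs' ++ [:: f v]); split.
- rewrite map_cat map_rev map_take fb take_takel // -catA; congr (_ ++ _ :: _).
  by apply: etrans fa _; rewrite (take_nth c0) // cm cats1.
- by case: (rev _).
by rewrite perm_cat2r perm_rev.
Qed.

Lemma phi_dary_tree d h k :
  (forall m, m <= h -> k ^ m < d) -> phi (dary_tree d h) <= k -> h < k.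
Proof.
move=> lt_d; rewrite /phi; case: ex_minnP => k' /boolp.asboolP[f f_free] _ le_k.
have lt_d' m : m <= h -> k' ^ m < d.
  move=> le_m; apply: leq_ltn_trans (lt_d m le_m).
  by case: m {le_m} => // m; rewrite leq_exp2r.
have d0 : 0 < d by apply: leq_ltn_trans (lt_d 0 _).
have [r [lr _]] := @ex_vertex d h 0 0 d0 isT isT.
have [|cs mono_r] := @ex_level_mono d h k' f h r lt_d'; first by rewrite lr.
have /card_uniqP := level_mono_uniq f_free mono_r; rewrite size_tuple => sz.
by apply: leq_trans le_k; rewrite -sz -[k' in _ <= k']card_ord max_card.
Qed.

Lemma ex_tree_pathwidth_phi p :
  exists T : sgraph, is_tree T /\ pathwidth T <= p <= phi T.
Proof.
(* [p ^ p] bounds the number of colour sequences of length at most [p]. *)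
pose d := (p ^ p).+2; exists (dary_tree d p); split.
  by split; [apply: dary_tree_connected | apply: dary_tree_acyclic].
rewrite pathwidth_dary_tree //= leqNgt; apply/negP => lt_phi.
have: p < p; last by rewrite ltnn.
apply: (@phi_dary_tree d p p) (ltnW lt_phi) => m le_m.
case: p @d lt_phi le_m => [|p] d _ le_m; first by case: m le_m.
by rewrite ltnS leqW // leq_pexp2l.
Qed.

Theorem theorem5 :
  (forall T : sgraph, is_tree T -> phi T <= 4 * pathwidth T + 1) /\
  (forall p : nat, exists T : sgraph, is_tree T /\ pathwidth T <= p <= phi T).
Proof.
split; last exact: ex_tree_pathwidth_phi.
by move=> T [_ acT]; apply: phi_le_pathwidth.
Qed.
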